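(* Let $1\le k<n$, $m+1=\binom nk$, and let $\sigma$ be a Plücker permutation of $\{0,1,\dots,m\}$. Then $\sigma\mathbf b=(b_{\sigma(0)},\dots,b_{\sigma(m)})$ is a Plücker weight vector for every Plücker weight vector $\mathbf b=(b_0,\dots,b_m)$.
   Context: Let $1\le k<n$ and $m+1=\binom nk$. A Schubert symbol for $k<n$ is a sequence $\lambda=(\lambda_1<\dots<\lambda_k)$ of integers in $\{1,\dots,n\}$ (identified with its underlying set). Write $\lambda\preceq\mu$ iff $\lambda_i\le\mu_i$ for all $i$, and fix a total order $\lambda^0<\lambda^1<\dots<\lambda^m$ of all Schubert symbols refining $\preceq$. With $e_1,\dots,e_n$ the standard basis of $\mathbb C^n$ and $e_\lambda=e_{\lambda_1}\wedge\dots\wedge e_{\lambda_k}$, identify $\Lambda^k(\mathbb C^n)$ with $\mathbb C^{m+1}$ by $z=\sum_i z_ie_{\lambda^i}$. Let $Pl(k,n)=\{a_1\wedge\dots\wedge a_k: a_i\in\mathbb C^n\}\setminus\{0\}$. $\mathbf b=(b_0,\dots,b_m)\in(\mathbb Z_{\ge1})^{m+1}$ is a Plücker weight vector if for all $1\le i_1<\dots<i_{k-1}\le n$ and $1\le\ell_0<\dots<\ell_k\le n$ the sum $b_{r_j}+b_{s_j}$ takes the same value for all $j\in\{0,\dots,k\}$ with $\ell_j\notin\{i_1,\dots,i_{k-1}\}$, where $\lambda^{r_j}=\{i_1,\dots,i_{k-1},\ell_j\}$ and $\lambda^{s_j}=\{\ell_0,\dots,\ell_k\}\setminus\{\ell_j\}$.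 A permutation $\sigma$ of $\{0,\dots,m\}$ is a Plücker permutation if there is a sign vector $t_\sigma=(t_0,\dots,t_m)\in\{1,-1\}^{m+1}$ such that $(t_0z_{\sigma(0)},\dots,t_mz_{\sigma(m)})\in Pl(k,n)$ for every $z=(z_0,\dots,z_m)\in Pl(k,n)$. *)

(* Defs.v *)
From mathcomp Require Import all_boot all_order all_algebra all_fingroup.

Set Implicit Arguments.
Unset Strict Implicit.
Unset Printing Implicit Defensive.

Import GRing.Theory.
Local Open Scope ring_scope.

(* The exterior algebra of F^n: [x S] is the coordinate of [x] on the basis
   vector e_S = e_{s_1} /\ ... /\ e_{s_p}, where S = {s_1 < ... < s_p}. *)
Notation ext F n := {ffun {set 'I_n} -> F^o}.

Definition ninv (n : nat) (A B : {set 'I_n}) : nat :=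
  (\sum_(i in A) \sum_(j in B) (j < i))%N.

(* e_A /\ e_B = (-1)^(ninv A B) e_(A :|: B) if A and B are disjoint, else 0. *)
Definition wedge (F : fieldType) (n : nat) (x y : ext F n) : ext F n :=
  [ffun S : {set 'I_n} => \sum_(A : {set 'I_n})
     \sum_(B : {set 'I_n} | [disjoint A & B] && (A :|: B == S))
       (-1) ^+ ninv A B * (x A * y B) : F^o].

Definition ext_one (F : fieldType) (n : nat) : ext F n :=
  [ffun S : {set 'I_n} => (S == set0)%:R : F^o].

Definition ext_vec (F : fieldType) (n : nat) (v : 'rV[F]_n) : ext F n :=
  [ffun S : {set 'I_n} => \sum_(i < n | S == [set i]) v 0 i : F^o].

(* a_0 /\ (a_1 /\ ( ... /\ (a_(k-1) /\ 1))) *)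
Definition wedges (F : fieldType) (n k : nat) (a : 'I_k -> 'rV[F]_n) : ext F n :=
  \big[@wedge F n/ext_one F n]_(i < k) ext_vec (a i).

(* Strictly increasing sequences of length p in {1, ..., n}, shifted to
   {0, ..., n-1}. *)
Notation incseq p n := {s : p.-tuple 'I_n | sorted ltn (map val s)}.

Definition seqat (p n : nat) (s : incseq p n) (i : 'I_p) : 'I_n :=
  tnth (val s) i.

Definition setof (p n : nat) (s : incseq p n) : {set 'I_n} :=
  [set x in tval (val s)].

Notation schubert k n := (incseq k n).

Definition schubert_le (k n : nat) (l mu : schubert k n) : Prop :=
  forall i : 'I_k, (seqat l i <= seqat mu i)%N.

(* [lam] lists all Schubert symbols, each once, in a total order refining
   [schubert_le]. *)
Definition schubert_enum (k n m : nat) (lam : 'I_m.+1 -> schubert k n) : Prop :=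
  bijective lam /\
  forall i j : 'I_m.+1, schubert_le (lam i) (lam j) -> (i <= j)%N.

Definition ext_basis (F : fieldType) (k n : nat) (l : schubert k n) : ext F n :=
  wedges (fun i : 'I_k => delta_mx 0 (seqat l i) : 'rV[F]_n).

Definition in_Pl (F : fieldType) (k n m : nat) (lam : 'I_m.+1 -> schubert k n)
    (z : 'rV[F]_m.+1) : Prop :=
  exists a : 'I_k -> 'rV[F]_n,
    \sum_(i < m.+1) z 0 i *: ext_basis F (lam i) = wedges a
    /\ wedges a <> 0.

Definition plucker_weight (k n m : nat) (lam : 'I_m.+1 -> schubert k n)
    (b : 'I_m.+1 -> nat) : Prop :=
  (forall i, (1 <= b i)%N) /\
  forall (I : incseq k.-1 n) (L : incseq k.+1 n) (j j' : 'I_k.+1)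
         (r s r' s' : 'I_m.+1),
    seqat L j \notin setof I -> seqat L j' \notin setof I ->
    setof (lam r) = seqat L j |: setof I ->
    setof (lam s) = setof L :\ seqat L j ->
    setof (lam r') = seqat L j' |: setof I ->
    setof (lam s') = setof L :\ seqat L j' ->
    (b r + b s = b r' + b s')%N.

Definition plucker_perm (F : fieldType) (k n m : nat)
    (lam : 'I_m.+1 -> schubert k n) (sigma : {perm 'I_m.+1}) : Prop :=
  exists t : 'I_m.+1 -> F,
    (forall i, t i = 1 \/ t i = -1) /\
    forall z : 'rV[F]_m.+1,
      in_Pl lam z -> in_Pl lam (\row_(i < m.+1) (t i * z 0 (sigma i))).

(* Sanity checks: associativity, v /\ v = 0, and the wedges e_lambda are the
   coordinate vectors of [ext]. *)
Lemma wedgeA (F : fieldType) (n : nat) : associative (@wedge F n).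
Proof.
have ninvUl (A B C : {set 'I_n}) : [disjoint A & B] ->
    ninv (A :|: B) C = (ninv A C + ninv B C)%N.
  by move=> dAB; rewrite /ninv -bigU //; apply: eq_bigl => i; rewrite !inE.
have ninvUr (A B C : {set 'I_n}) : [disjoint B & C] ->
    ninv A (B :|: C) = (ninv A B + ninv A C)%N.
  move=> dBC; rewrite /ninv -big_split; apply: eq_bigr => i _ /=.
  by rewrite -bigU //; apply: eq_bigl => j; rewrite !inE.
move=> x y z; apply/ffunP => S; rewrite !ffunE.
pose G (A B C : {set 'I_n}) : F := if [&& [disjoint A & B], [disjoint A & C], [disjoint B & C]
   & A :|: B :|: C == S] then
   (-1) ^+ (ninv A B + ninv A C + ninv B C) * (x A * y B * z C) else 0.
transitivity (\sum_A \sum_B \sum_C G A B C).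
  apply: eq_bigr => A _.
  under eq_bigr do rewrite ffunE !mulr_sumr.
  rewrite exchange_big /=; apply: eq_bigr => B _.
  under eq_bigr do rewrite !mulr_sumr big_mkcond /=.
  rewrite exchange_big /=; apply: eq_bigr => C _.
  rewrite big_mkcond (bigD1 (B :|: C)) //= big1 ?addr0; last first.
    by move=> D nD; rewrite [B :|: C == D]eq_sym (negPf nD) andbF; case: ifP.
  rewrite eqxx andbT /G setUA.
  have -> : [disjoint A & B :|: C] = [disjoint A & B] && [disjoint A & C].
    by rewrite -!setI_eq0 setIUr setU_eq0.
  case dAB: [disjoint A & B] => //=; case dAC: [disjoint A & C] => //=.
  case dBC: [disjoint B & C] => /=; last by case: ifP.
  case: ifP => // _; rewrite ninvUr // !exprD -!mulrA; congr (_ * (_ * _)).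
  by rewrite mulrCA.
symmetry.
under eq_bigr do under eq_bigr do rewrite ffunE mulr_suml mulr_sumr.
under eq_bigr do rewrite exchange_big /=.
rewrite exchange_big /=; apply: eq_bigr => A _.
under eq_bigr do under eq_bigr do rewrite mulr_suml mulr_sumr big_mkcond /=.
under eq_bigr do rewrite exchange_big /=.
rewrite exchange_big /=; apply: eq_bigr => B _.
under eq_bigr do rewrite big_mkcond /=.
rewrite exchange_big /=; apply: eq_bigr => C _.
rewrite (bigD1 (A :|: B)) //= big1 ?addr0; last first.
  by move=> D nD; rewrite [A :|: B == D]eq_sym (negPf nD) andbF; case: ifP.
rewrite eqxx andbT /G.
have -> : [disjoint A :|: B & C] = [disjoint A & C] && [disjoint B & C].
  by rewrite -!setI_eq0 setIUl setU_eq0.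
case dAB: [disjoint A & B] => //=; last by case: ifP.
case dAC: [disjoint A & C] => //=; case dBC: [disjoint B & C] => //=.
case: ifP => // _; rewrite ninvUl // -[(_ + _ + _)%N in RHS]addnA.
by rewrite [in RHS]addnC !exprD !mulrA.
Qed.

Lemma wedge_vecvv (F : fieldType) (n : nat) (v : 'rV[F]_n) :
  wedge (ext_vec v) (ext_vec v) = [ffun=> 0].
Proof.
apply/ffunP => S; rewrite !ffunE.
pose H (i j : 'I_n) : F := if (i != j) && ([set i; j] == S) then
  (-1) ^+ (j < i)%N * (v 0 i * v 0 j) else 0.
transitivity (\sum_i \sum_j H i j).
  under eq_bigr do under eq_bigr do rewrite !ffunE mulr_suml mulr_sumr big_mkcond.
  under eq_bigr do rewrite exchange_big /=.
  rewrite exchange_big /=; apply: eq_bigr => i _.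
  rewrite (bigD1 [set i]) //= [X in _ + X]big1 ?addr0; last first.
    by move=> A nA; rewrite big1 // => B _; rewrite (negPf nA).
  under eq_bigr do rewrite eqxx !mulr_sumr big_mkcond.
  rewrite exchange_big /=; apply: eq_bigr => j _; rewrite big_mkcond /=.
  rewrite (bigD1 [set j]) //= [X in _ + X]big1 ?addr0; last first.
    by move=> B nB; rewrite (negPf nB); case: ifP.
  by rewrite eqxx disjoints1 inE /H /ninv !big_set1.
have HN i j : H j i + H i j = 0.
  rewrite /H [j == i]eq_sym setUC; case: ltngtP => [ij|ji|/val_inj->].
  - case: ifP => _; last by rewrite addr0.
    by rewrite expr0 expr1 mulN1r mul1r [v 0 i * _]mulrC addrC subrr.
  - case: ifP => _; last by rewrite addr0.
    by rewrite expr0 expr1 mulN1r mul1r [v 0 i * _]mulrC subrr.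
  by rewrite eqxx addr0.
have Hii i : H i i = 0 by rewrite /H eqxx.
transitivity (\sum_(i < n) \sum_(j < n) ((if (i < j)%N then H i j else 0) +
                             (if (j < i)%N then H i j else 0))).
  apply: eq_bigr => i _; apply: eq_bigr => j _.
  by case: ltngtP => [||/val_inj->]; rewrite ?addr0 ?add0r ?Hii.
under eq_bigr do rewrite big_split.
rewrite big_split /= [X in _ + X]exchange_big /= -big_split big1 // => i _.
rewrite -big_split big1 // => j _ /=.
by case: ifP => _; rewrite ?addr0 // addrC HN.
Qed.

Lemma ext_basisE (F : fieldType) (k n : nat) (l : schubert k n) :
  ext_basis F l = [ffun S : {set 'I_n} => (S == setof l)%:R : F^o].
Proof.
rewrite /ext_basis /wedges /seqat /setof.
rewrite -(big_tuple _ _ (val l) xpredT (fun i => ext_vec (delta_mx 0 i))).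
case: l => t /=; elim: (tval t) => [|x s IHs] /= s_lt.
  by rewrite big_nil; apply/ffunP => S; rewrite !ffunE; congr (_ == _)%:R;
     apply/setP => i; rewrite !inE.
rewrite big_cons IHs; last exact: path_sorted s_lt.
have vecx : ext_vec (delta_mx 0 x) =
    [ffun S : {set 'I_n} => (S == [set x])%:R : F^o].
  apply/ffunP => S; rewrite !ffunE big_mkcond (bigD1 x) //= big1 => [|i nix].
    by rewrite !mxE !eqxx addr0; case: eqP.
  by rewrite !mxE (negPf nix) andbF; case: ifP.
have x_lt j : j \in s -> (x < j)%N.
  move=> js; move: s_lt; rewrite path_sortedE; last exact: ltn_trans.
  by case/andP => /allP + _; apply; apply: map_f.
rewrite vecx; apply/ffunP => S; rewrite !ffunE.
rewrite (bigD1 [set x]) //= [X in _ + X]big1 ?addr0; last first.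
  by move=> A nA; rewrite big1 // => B _; rewrite !ffunE (negPf nA) mul0r mulr0.
rewrite big_mkcond (bigD1 [set y in s]) //= [X in _ + X]big1 ?addr0; last first.
  by move=> B nB; case: ifP => // _; rewrite !ffunE (negPf nB) !mulr0.
have -> : [disjoint [set x] & [set y in s]].
  by rewrite disjoints1 inE; apply/negP => /x_lt; rewrite ltnn.
have -> : ninv [set x] [set y in s] = 0%N.
  rewrite /ninv big_set1 big1 // => j; rewrite inE => /x_lt xj.
  by rewrite ltnNge ltnW.
have -> : [set y in x :: s] = [set x] :|: [set y in s].
  by apply/setP => y; rewrite !inE.
by rewrite !ffunE !eqxx expr0 !mulr1 eq_sym; case: eqP.
Qed.

(* Main.v *)
Require Import Defs.
From mathcomp Require Import all_boot all_order all_algebra all_fingroup.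
From mathcomp Require Import reals complex.

(** Call b a weight vector and let D_q scale the coordinate z_i by q^(b_i).
    Summing the exchange relations, some multiple N b_S is a constant plus the
    sum over x in S of integers c_x; hence D_q, for q = 2^N, is up to a scalar
    induced by a diagonal matrix of F^n and preserves Pl(k, n).  If T is the
    signed permutation of a Pluecker permutation sigma, then T^-1 is a power of T
    and T D_q T^-1, which scales z_i by q^(b_(sigma i)), preserves Pl(k, n) too.
    Conversely this forces sigma b to be a weight vector.  The condition says
    that b(K + x) + b(K' + y) = b(K + y) + b(K' + x) for (k-1)-sets K, K' not
    containing x, y.  Choose omega = (e_x + e_y) /\ u_1 /\ ... /\ u_(k-1) with
    u_1 /\ ... /\ u_(k-1) supported away from x, y and non-zero at K and K'.
    Both omega and its rescaling are decomposable and vanish on sets containing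
    x and y, so each satisfies the Pluecker relation reduced to its two terms
    omega_(K+x) omega_(K'+y) and omega_(K+y) omega_(K'+x); compare. *)

Set Implicit Arguments.
Unset Strict Implicit.
Unset Printing Implicit Defensive.

Import GRing.Theory Num.Theory.
Local Open Scope ring_scope.

(** * Coordinates of decomposable vectors in the exterior algebra *)

Section Exterior.
Variables (F : fieldType) (n : nat).
Implicit Types (u v : 'rV[F]_n) (x y : ext F n) (S T : {set 'I_n}).

(** Only singletons [A = [set i]] contribute to the left factor, and then [B] is forced to be
    [S :\ i]. *)
Lemma wedge_vecE v x S : wedge (ext_vec v) x S =
  \sum_(i in S) (-1) ^+ ninv [set i] (S :\ i) * (v 0 i * x (S :\ i)).
Proof.
rewrite ffunE.
transitivity (\sum_(i < n) \sum_(A : {set 'I_n} | A == [set i])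
    \sum_(B : {set 'I_n} | [disjoint A & B] && (A :|: B == S))
       (-1) ^+ ninv A B * (v 0 i * x B) : F).
  under eq_bigr do under eq_bigr do rewrite ffunE mulr_suml mulr_sumr big_mkcond.
  under eq_bigr do rewrite exchange_big /=.
  rewrite exchange_big /=; apply: eq_bigr => i _.
  rewrite [RHS]big_mkcond; apply: eq_bigr => A _.
  by case: ifP => // _; rewrite big1.
rewrite [RHS]big_mkcond; apply: eq_bigr => i _; rewrite big_pred1_eq.
under eq_bigl => B.
  rewrite disjoints1 (_ : _ && _ = (i \in S) && (B == S :\ i)); last first.
    apply/andP/andP => -[iB /eqP DS].
      by rewrite -DS setU11 setU1K.
    by rewrite DS setD11 setD1K.
  over.
by case: ifP => _; [rewrite big_pred1_eq|rewrite big_pred0].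
Qed.

Lemma wedgeDl x y z : wedge (x + y) z = wedge x z + wedge y z.
Proof.
apply/ffunP => S; rewrite !ffunE -big_split; apply: eq_bigr => A _ /=.
by rewrite -big_split; apply: eq_bigr => B _ /=; rewrite ffunE mulrDl mulrDr.
Qed.

Lemma wedgeDr x y z : wedge x (y + z) = wedge x y + wedge x z.
Proof.
apply/ffunP => S; rewrite !ffunE -big_split; apply: eq_bigr => A _ /=.
by rewrite -big_split; apply: eq_bigr => B _ /=; rewrite ffunE !mulrDr.
Qed.

Lemma wedge0x x : wedge 0 x = 0.
Proof. by apply: (addIr (wedge 0 x)); rewrite -wedgeDl !add0r. Qed.

Lemma wedgex0 x : wedge x 0 = 0.
Proof. by apply: (addIr (wedge x 0)); rewrite -wedgeDr !add0r. Qed.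

Lemma ext_vecD u v : ext_vec (u + v) = ext_vec u + ext_vec v.
Proof.
apply/ffunP => S; rewrite !ffunE -big_split.
by apply: eq_bigr => i _; rewrite mxE.
Qed.

Lemma wedge_vv v x : wedge (ext_vec v) (wedge (ext_vec v) x) = 0.
Proof.
by rewrite wedgeA wedge_vecvv wedge0x.
Qed.

(** Polarisation of [wedge_vv] at [u + v]. *)
Lemma wedge_vecC u v x : wedge (ext_vec u) (wedge (ext_vec v) x) =
  - wedge (ext_vec v) (wedge (ext_vec u) x).
Proof.
apply/eqP; rewrite -addr_eq0; have := wedge_vv (u + v) x.
rewrite ext_vecD !(wedgeDl, wedgeDr) !wedge_vv add0r addr0 => <-.
by rewrite addrC.
Qed.

Lemma wedgesS k (a : 'I_k.+1 -> 'rV[F]_n) :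
  wedges a = wedge (ext_vec (a ord0)) (wedges (fun i => a (lift ord0 i))).
Proof. by rewrite /wedges big_ord_recl. Qed.

Lemma wedges_cons k v (u : 'I_k -> 'rV[F]_n) :
  wedges (fun i => if unlift ord0 i is Some j then u j else v) =
  wedge (ext_vec v) (wedges u).
Proof.
by rewrite wedgesS unlift_none /wedges; under eq_bigr do rewrite liftK.
Qed.

Lemma wedge_wedges k (a : 'I_k -> 'rV[F]_n) i :
  wedge (ext_vec (a i)) (wedges a) = 0.
Proof.
elim: k a i => [|k IHk] a i; first by case: i.
rewrite wedgesS; case: (unliftP ord0 i) => [j|] ->; last exact: wedge_vv.
rewrite wedge_vecC (IHk (fun j => a (lift ord0 j))) wedgex0.
by apply/ffunP => S; rewrite !ffunE oppr0.
Qed.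

Lemma wedges_card k (a : 'I_k -> 'rV[F]_n) S : wedges a S != 0 -> #|S| = k.
Proof.
elim: k a S => [|k IHk] a S.
  rewrite /wedges big_ord0 ffunE.
  by case: (eqVneq S set0) => [->|_]; rewrite ?cards0 ?eqxx.
rewrite wedgesS wedge_vecE => nz; apply/eqP; apply: contraNT nz => cS.
rewrite big1 // => i iS; rewrite (_ : wedges _ _ = 0) ?mulr0 //.
apply/eqP; apply: contraNT cS => /IHk.
by rewrite (cardsD1 i S) iS => ->.
Qed.

Lemma wedges_support k (a : 'I_k -> 'rV[F]_n) (X : {set 'I_n}) S :
  (forall i j, j \notin X -> a i 0 j = 0) -> wedges a S != 0 -> S \subset X.
Proof.
elim: k a S => [|k IHk] a S aX.
  rewrite /wedges big_ord0 ffunE.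
  by case: (eqVneq S set0) => [->|_]; rewrite ?sub0set ?eqxx.
rewrite wedgesS wedge_vecE => nz; apply: contraNT nz => /subsetPn[j jS jX].
rewrite big1 // => i iS; have [->|ij] := eqVneq i j.
  by rewrite aX // mul0r mulr0.
rewrite (_ : wedges _ _ = 0) ?mulr0 //; apply/eqP; apply: contraNT jX => nz.
have /subsetP := IHk (fun i => a (lift ord0 i)) _ (fun i => aX _) nz.
by apply; rewrite !inE eq_sym ij.
Qed.

Lemma wedges_diag k (a : 'I_k -> 'rV[F]_n) (g : 'I_n -> F) S :
  wedges (fun i => \row_j (g j * a i 0 j)) S = (\prod_(j in S) g j) * wedges a S.
Proof.
elim: k a S => [|k IHk] a S.
  rewrite /wedges !big_ord0 ffunE; case: (eqVneq S set0) => [->|_]; last by rewrite mulr0.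
  by rewrite big_set0 mulr1.
rewrite !wedgesS !wedge_vecE mulr_sumr; apply: eq_bigr => i iS.
rewrite (IHk (fun i => a (lift ord0 i))) mxE (big_setD1 i iS) /= [RHS]mulrCA.
by congr (_ * _); exact: mulrACA.
Qed.

Lemma wedges_scale k (a : 'I_k.+1 -> 'rV[F]_n) (c : F) S :
  wedges (fun i => if i == ord0 then c *: a i else a i) S = c * wedges a S.
Proof.
rewrite !wedgesS !wedge_vecE mulr_sumr; apply: eq_bigr => i iS /=.
by rewrite mxE [RHS]mulrCA; congr (_ * _); exact/esym/mulrA.
Qed.

(* Every factor [v] of [wedges w] has [v /\ wedges w = 0]; at [a |: (b |: K)]
   this reads [v_a w_(b |: K) = +/- v_b w_(a |: K)], and likewise for [K']. Squaring
   spares the computation of the signs. *)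
Lemma wedges_two_term k (w : 'I_k -> 'rV[F]_n) (K K' : {set 'I_n}) (a b : 'I_n) :
  a != b -> a \notin K -> b \notin K -> a \notin K' -> b \notin K' ->
  (forall T, a \in T -> b \in T -> wedges w T = 0) ->
  (wedges w (a |: K) * wedges w (b |: K')) ^+ 2 =
  (wedges w (b |: K) * wedges w (a |: K')) ^+ 2.
Proof.
move=> ab aK bK aK' bK' w0.
have rel i (J : {set 'I_n}) : a \notin J -> b \notin J ->
    (w i 0 a * wedges w (b |: J)) ^+ 2 = (w i 0 b * wedges w (a |: J)) ^+ 2.
  move=> aJ bJ; have := wedge_vecE (w i) (wedges w) (a |: (b |: J)).
  rewrite wedge_wedges ffunE (bigD1 a) ?setU11 //= (bigD1 b) /=; last first.
    by rewrite !inE eqxx orbT eq_sym.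
  rewrite big1 => [|j /andP[/andP[_ ja] jb]]; last first.
    by rewrite w0 ?mulr0 // !inE eqxx ?orbT eq_sym ?ja ?jb.
  rewrite addr0 setU1K ?inE ?negb_or ?ab //.
  rewrite [a |: (b |: J)]setUCA [(b |: _) :\ b]setU1K ?inE ?negb_or 1?eq_sym ?ab //.
  by move/esym/eqP; rewrite addr_eq0 => /eqP/(congr1 (fun x : F => x ^+ 2));
     rewrite sqrrN !exprMn -!exprM ![(_ * 2)%N]mulnC !exprM sqrrN !expr1n !mul1r.
(* If some factor is non-zero at [a] or [b], that coefficient can be cancelled from the two
   relations. Otherwise every factor is supported off [a] and [b], and both sides vanish. *)
have [/existsP[i /orP nz]|all0] :=
    boolP [exists i, (w i 0 a != 0) || (w i 0 b != 0)].
  have e := rel i _ aK bK; have e' := rel i _ aK' bK'.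
  move: e e'; rewrite !exprMn.
  move: (w i 0 a) (w i 0 b) nz => A B nz.
  move: (wedges w (a |: K)) (wedges w (b |: K)) => p r.
  move: (wedges w (a |: K')) (wedges w (b |: K')) => s q e e'.
  case: nz => nz; apply: (mulfI (expf_neq0 2 nz)).
    by rewrite mulrCA e' mulrA [p ^+ 2 * _]mulrC -e -mulrA.
  by rewrite mulrA -e -mulrA mulrCA e' mulrCA.
have out T : (a \in T) || (b \in T) -> wedges w T = 0 :> F.
  move=> abT; apply/eqP; apply: contraTT abT => nz; rewrite negb_or.
  suff /subsetP sT : T \subset ~: [set a; b].
    by apply/andP; split; apply/negP => /sT; rewrite !inE eqxx ?orbT.
  apply: wedges_support nz => i j; rewrite !inE negbK.
  move: all0; rewrite negb_exists => /forallP/(_ i).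
  by rewrite negb_or !negbK => /andP[/eqP wa /eqP wb] /orP[] /eqP ->.
have aaK : (a \in a |: K) || (b \in a |: K) by rewrite setU11.
have bbK : (a \in b |: K) || (b \in b |: K) by rewrite setU11 orbT.
by rewrite (out _ aaK) (out _ bbK) !mul0r.
Qed.

(** Induction on [p]: remove [x] from [K] and [y] from [K'], and put one new factor supported on [x]
    and [y] in front of the vectors found for the smaller sets. *)
Lemma wedges_two_sets p (K K' : {set 'I_n}) : #|K| = p -> #|K'| = p ->
  exists u : 'I_p -> 'rV[F]_n,
    [/\ forall i j, j \notin K :|: K' -> u i 0 j = 0,
        wedges u K != 0 & wedges u K' != 0].
Proof.
elim: p K K' => [|p IHp] K K' cK cK'.
  exists (fun=> 0); split=> [i||]; first by case: i.
    by rewrite (cards0_eq cK) /wedges big_ord0 ffunE eqxx oner_eq0.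
  by rewrite (cards0_eq cK') /wedges big_ord0 ffunE eqxx oner_eq0.
(* This choice makes [x] the only point of [K], and [y] the only point of [K'], where [v] below is
   non-zero, so each expansion keeps a single term. *)
have [x [y [xK yK' xy]]] : exists x y : 'I_n, [/\ x \in K, y \in K' &
    (x == y) || (x \notin K') && (y \notin K)].
  have [/eqP KK'|/set0Pn[x /setIP[xK xK']]] := boolP (K :&: K' == set0); last first.
    by exists x, x; rewrite eqxx.
  have /set0Pn[x xK] : K != set0 by rewrite -card_gt0 cK.
  have /set0Pn[y yK'] : K' != set0 by rewrite -card_gt0 cK'.
  exists x, y; split=> //; apply/orP; right.
  move/setP: KK' => KK'; have := KK' x; have := KK' y.
  by rewrite !inE xK yK' andbT /= => -> ->.
have cKx : #|K :\ x| = p by apply/eqP; rewrite -eqSS -cK (cardsD1 x K) xK.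
have cKy : #|K' :\ y| = p by apply/eqP; rewrite -eqSS -cK' (cardsD1 y K') yK'.
have [u [uX uK uK']] := IHp _ _ cKx cKy.
(* The disjunction gives e_x rather than 2 e_x when [x = y], so that [v] takes the value 1 there in
   every characteristic. *)
pose v : 'rV[F]_n := \row_j ((j == x) || (j == y))%:R.
pose u' i := if unlift ord0 i is Some j then u j else v : 'rV[F]_n.
have nz (J : {set 'I_n}) z : z \in J -> v 0 z = 1 ->
    (forall i, i \in J -> i != z -> v 0 i = 0) -> wedges u (J :\ z) != 0 ->
    wedges u' J != 0.
  move=> zJ vz v0 uJ; rewrite wedges_cons wedge_vecE (bigD1 z) //= big1 => [|i /andP[iJ iz]].
    by rewrite addr0 vz mul1r mulf_neq0 // signr_eq0.
  by rewrite v0 // mul0r mulr0.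
exists u'; split.
- move=> i j; rewrite inE negb_or => /andP[jK jK']; rewrite /u'.
  case: unliftP => [l _|_]; first by apply: uX; rewrite !inE (negPf jK) (negPf jK') !andbF.
  rewrite mxE; case: eqVneq => [jx|_]; first by rewrite jx xK in jK.
  by case: eqVneq => [jy|//]; rewrite jy yK' in jK'.
- apply: (nz _ x) => //; first by rewrite mxE eqxx.
  move=> i iK ix; rewrite mxE (negPf ix) /=; case: eqVneq => [iy|//].
  by move: xy ix; rewrite -iy iK andbF orbF eq_sym => ->.
- apply: (nz _ y) => //; first by rewrite mxE eqxx orbT.
  move=> i iK ix; rewrite mxE (negPf ix) orbF; case: eqVneq => [iy|//].
  by move: xy ix; rewrite -iy iK orbF => ->.
Qed.

End Exterior.

(** * Increasing sequences as sets of fixed cardinality *)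

Section IncreasingSequences.
Variables (p n : nat).
Implicit Types (s : incseq p n) (S : {set 'I_n}).

Lemma mem_seqat s j : seqat s j \in setof s.
Proof. by rewrite inE mem_tnth. Qed.

Lemma setof_seqat s x : x \in setof s -> exists j, seqat s j = x.
Proof. by rewrite inE => /tnthP[j ->]; exists j. Qed.

Lemma uniq_incseq s : uniq (val s).
Proof.
apply: (@map_uniq _ _ val); apply: sorted_uniq (valP s); first exact: ltn_trans.
exact: ltnn.
Qed.

Lemma card_setof s : #|setof s| = p.
Proof. by rewrite cardsE (card_uniqP (uniq_incseq s)) size_tuple. Qed.

Lemma setof_inj : injective (@setof p n).
Proof.
move=> s s' /setP ss'; do 2!apply: val_inj; apply: (inj_map val_inj).
apply: (irr_sorted_eq ltn_trans ltnn (valP s) (valP s')) => i.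
apply/mapP/mapP => -[x xs ->]; exists x => //.
  by have := ss' x; rewrite !inE xs.
by have := ss' x; rewrite !inE xs.
Qed.

Lemma setof_surj S : #|S| = p -> exists s, setof s = S.
Proof.
move=> cS; have sz : size (enum S) == p by rewrite -cardE cS.
have srt : sorted ltn (map val (enum S)).
  rewrite /enum_mem sorted_map; apply: sorted_filter.
    by move=> i j l; apply: ltn_trans.
  by rewrite -sorted_map -enumT val_enum_ord iota_ltn_sorted.
by exists (exist _ (Tuple sz) srt); apply/setP => x; rewrite inE mem_enum.
Qed.

End IncreasingSequences.

(** * Set functions satisfying the exchange relations *)

Section ExchangeWeights.
Variables (n k : nat) (B : {set 'I_n} -> nat).
Hypothesis ltkn : (k.+1 < n)%N.
Hypothesis exB : forall (K K' : {set 'I_n}) (a b : 'I_n), #|K| = k -> #|K'| = k ->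
  a != b -> a \notin K -> b \notin K -> a \notin K' -> b \notin K' ->
  (B (a |: K) + B (b |: K') = B (b |: K) + B (a |: K'))%N.

Let N := 'C(n - 2, k).
Let c (a : 'I_n) := (\sum_(S : {set 'I_n} | (#|S| == k.+1) && (a \in S)) B S)%N.

(** Sum the exchange relation over the [N] sets [K'] of size [k] that avoid [a] and [b]. The sets
    containing both points contribute equally to [c a] and [c b], so the remaining sums may be
    completed to [c a] and [c b]. *)
Lemma exchange_weight_step (K : {set 'I_n}) (a b : 'I_n) : #|K| = k -> a != b ->
  a \notin K -> b \notin K -> (N * B (a |: K) + c b = N * B (b |: K) + c a)%N.
Proof.
move=> cK ab aK bK.
pose D := [set A : {set 'I_n} | (A \subset ~: [set a; b]) && (#|A| == k)].
have DP (A : {set 'I_n}) : (A \in D) = [&& a \notin A, b \notin A & #|A| == k].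
  by rewrite inE subsetC subUset !sub1set !in_setC -andbA.
have cD : #|D| = N.
  rewrite cards_draws /N; congr ('C(_, _)); have := cardsC [set a; b].
  by rewrite cards2 ab card_ord => /(congr1 (subn^~ 2)); rewrite addKn.
have cE x y : x != y -> (c x = \sum_(S : {set 'I_n} | [&& #|S| == k.+1, x \in S & y \in S]) B S +
    \sum_(A : {set 'I_n} | [&& x \notin A, y \notin A & #|A| == k]) B (x |: A))%N.
  move=> xy; rewrite /c (bigID (fun S : {set 'I_n} => y \in S)) /=.
  congr (_ + _)%N; first by apply: eq_bigl => S; rewrite andbA.
  rewrite (reindex_onto (fun A => x |: A) (fun S => S :\ x)) /=; last first.
    by move=> S /andP[/andP[_ xS] _]; rewrite setD1K.
  apply: eq_bigl => A; rewrite setU11 andbT !inE [y == x]eq_sym (negPf xy) /=.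
  have [xA|xA] /= := boolP (x \in A).
    rewrite andbC; case: eqP => //= /setP/(_ x).
    by rewrite !inE eqxx xA.
  by rewrite setU1K // eqxx andbT cardsU1 xA eqSS andbC.
have ND f : (N * f = \sum_(A in D) f)%N by rewrite sum_nat_const cD.
rewrite (cE a b) // (cE b a) 1?eq_sym // !ND.
have -> : (\sum_(S : {set 'I_n} | [&& #|S| == k.+1, b \in S & a \in S]) B S =
    \sum_(S : {set 'I_n} | [&& #|S| == k.+1, a \in S & b \in S]) B S)%N.
  by apply: eq_bigl => S; rewrite [(b \in S) && _]andbC.
rewrite [LHS]addnCA [RHS]addnCA; congr (_ + _)%N.
have -> : (\sum_(A : {set 'I_n} | [&& b \notin A, a \notin A & #|A| == k]) B (b |: A) =
    \sum_(A in D) B (b |: A))%N by apply: eq_bigl => A; rewrite DP andbCA.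
have -> : (\sum_(A : {set 'I_n} | [&& a \notin A, b \notin A & #|A| == k]) B (a |: A) =
    \sum_(A in D) B (a |: A))%N by apply: eq_bigl => A; rewrite DP.
rewrite -big_split -[RHS]big_split /=; apply: eq_bigr => A.
by rewrite DP => /and3P[aA bA /eqP cA]; apply: exB.
Qed.

(** Induction on the size of [S :\: S']: trading a point of [S :\: S'] for one of [S' :\: S] brings
    [S] closer to [S'], and [exchange_weight_step] computes the change. The identity is arranged to
    avoid subtraction. *)
Lemma exchange_weight_linear : exists N : nat, (0 < N)%N /\
  exists c : 'I_n -> nat, forall S S' : {set 'I_n}, #|S| = k.+1 -> #|S'| = k.+1 ->
    (N * B S + \sum_(i in S') c i = N * B S' + \sum_(i in S) c i)%N.
Proof.
exists N; split; first by rewrite bin_gt0 leq_subRL //; apply: leq_ltn_trans ltkn.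
exists c => S S'; move: {2}#|S :\: S'| (erefl #|S :\: S'|) => d.
elim: d S => [|d IHd] S dS cS cS'.
  suff -> : S = S' by [].
  by apply/eqP; rewrite eqEcard cS cS' leqnn andbT -setD_eq0 -cards_eq0 dS.
have /card_gt0P[a /setDP[aS aS']] : (0 < #|S :\: S'|)%N by rewrite dS.
have /card_gt0P[b /setDP[bS' bS]] : (0 < #|S' :\: S|)%N.
  by rewrite cardsD setIC cS' -cS -cardsD dS.
have ab : a != b by apply: contraNneq aS' => ->.
pose K := S :\ a; have cK : #|K| = k.
  by apply/eqP; rewrite -eqSS -cS (cardsD1 a S) aS.
have bK : b \notin K by rewrite !inE negb_and bS orbT.
have aK : a \notin K by rewrite setD11.
have := exchange_weight_step cK ab aK bK; rewrite setD1K // => e1.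
have := IHd (b |: K) _ _ cS'; rewrite big_setU1 //= [(\sum_(i in S) c i)%N](big_setD1 a) //=.
rewrite cardsU1 bK cK => /(_ _ erefl) e2.
have {}e2 : (N * B (b |: K) + \sum_(i in S') c i = N * B S' + (c b + \sum_(i in K) c i))%N.
  apply: e2; rewrite (_ : _ :\: _ = (S :\: S') :\ a).
    by apply/eqP; rewrite -eqSS -dS (cardsD1 a (S :\: S')) inE aS aS'.
  apply/setP => x; rewrite !inE; case: eqVneq => [->|_] /=; last by rewrite andbCA.
  by rewrite bS' (negPf bS) !andbF.
apply: (@addIn (c b)); rewrite addnAC e1 addnAC e2.
by rewrite -!addnA; congr (_ + _)%N; rewrite addnCA addnA addnC.
Qed.

End ExchangeWeights.

(** * The cone Pl(k, n), its diagonal symmetries and signed permutations *)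

Section PlueckerCone.
Variables (F : fieldType) (k n m : nat) (lam : 'I_m.+1 -> schubert k n).
Hypothesis lam_bij : bijective lam.
Implicit Type z : 'rV[F]_m.+1.

Lemma setof_lam_inj : injective (fun i => setof (lam i)).
Proof. by move=> i j /setof_inj/(bij_inj lam_bij). Qed.

Lemma setof_lam_surj (S : {set 'I_n}) : #|S| = k -> exists i, setof (lam i) = S.
Proof.
case: lam_bij => f _ fK /setof_surj[s <-].
by exists (f s); rewrite fK.
Qed.

Lemma sum_ext_basisE z S : (\sum_i z 0 i *: ext_basis F (lam i)) S =
  \sum_(i | setof (lam i) == S) z 0 i.
Proof.
rewrite sum_ffunE [RHS]big_mkcond; apply: eq_bigr => i _.
rewrite ext_basisE !ffunE eq_sym; case: eqP => _.
  exact: mulr1.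
exact: mulr0.
Qed.

(** Coordinates of a [k]-fold wedge vanish off sets of size [k], and [lam] enumerates exactly those
    sets. *)
Lemma in_PlP z : in_Pl lam z <-> exists a : 'I_k -> 'rV[F]_n,
  (forall i, wedges a (setof (lam i)) = z 0 i) /\ wedges a <> 0.
Proof.
have coef i : \sum_(j | setof (lam j) == setof (lam i)) z 0 j = z 0 i.
  by apply: big_pred1 => j; rewrite (inj_eq setof_lam_inj).
split=> -[a [za nz]]; exists a; split=> //.
  by move=> i; rewrite -za sum_ext_basisE.
apply/ffunP => S; rewrite sum_ext_basisE.
have [/eqP/setof_lam_surj[i <-]|cS] := boolP (#|S| == k); first by rewrite za.
rewrite big_pred0 => [|i].
  by apply/esym/eqP; apply: contraNT cS => /wedges_card ->.
by apply: contraNF cS => /eqP <-; rewrite card_setof.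
Qed.

(** The diagonal matrix [g] acts on every factor; the scalar [c] is absorbed by the first factor,
    which exists since [k] is positive. *)
Lemma in_Pl_diag z (g : 'I_n -> F) (c : F) : (0 < k)%N -> c != 0 ->
  (forall i, g i != 0) -> in_Pl lam z ->
  in_Pl lam (\row_i (c * (\prod_(j in setof (lam i)) g j) * z 0 i)).
Proof.
case: k lam in_PlP => // k' lam' PlP _ c0 g0 /PlP[a [za nz]]; apply/PlP.
pose a' i := \row_j (g j * a i 0 j).
pose a'' i := if i == ord0 then c *: a' i else a' i.
have a''E S : wedges a'' S = c * ((\prod_(j in S) g j) * wedges a S).
  by rewrite wedges_scale wedges_diag.
exists a''; split=> [i|a''0]; first by rewrite a''E za mxE mulrA.
apply: nz; apply/ffunP => S; move/ffunP/(_ S): a''0.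
rewrite a''E !ffunE => /eqP; rewrite !mulf_eq0 (negPf c0) /=.
case/orP => /eqP // /eqP/prodf_eq0[j _].
by rewrite (negPf (g0 j)).
Qed.

Lemma signed_perm_iter (t : 'I_m.+1 -> F) (sigma : {perm 'I_m.+1}) N :
  (forall i, t i = 1 \/ t i = -1) ->
  exists s : 'I_m.+1 -> F, (forall i, s i * s i = 1) /\
    forall z, iter N (fun z => \row_i (t i * z 0 (sigma i))) z =
      \row_i (s i * z 0 ((sigma ^+ N)%g i)).
Proof.
move=> t1; elim: N => [|N [s [s1 sE]]].
  exists (fun=> 1); split=> [i|z]; first exact: mulr1.
  by apply/rowP => i; rewrite mxE mul1r perm1.
exists (fun i => t i * s (sigma i)); split=> [i|z].
  by rewrite mulrACA s1 mulr1; case: (t1 i) => ->; rewrite ?mulrNN mulr1.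
by apply/rowP => i; rewrite iterS sE !mxE mulrA expgS permM.
Qed.

(* A signed permutation matrix has finite order, so a Pluecker permutation acts
   bijectively on the cone. *)
Lemma plucker_perm_surj (t : 'I_m.+1 -> F) (sigma : {perm 'I_m.+1}) z :
  let Phi z : 'rV[F]_m.+1 := \row_i (t i * z 0 (sigma i)) in
  (forall i, t i = 1 \/ t i = -1) ->
  (forall z, in_Pl lam z -> in_Pl lam (Phi z)) ->
  in_Pl lam z -> exists2 y, in_Pl lam y & Phi y = z.
Proof.
move=> Phi t1 PhiPl zPl.
have [s [s1 sE]] := signed_perm_iter sigma #[sigma]%g t1.
have iterPl N : in_Pl lam (iter N Phi z) by elim: N => //= N; apply: PhiPl.
(* After one period of [sigma] only signs remain; a second period squares them away. The preimage of
   [z] is thus the iterate just before the end. *)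
have: iter (#[sigma]%g + #[sigma]%g) Phi z = z.
  rewrite iterD !sE expg_order; apply/rowP => i.
  by rewrite !mxE !perm1 mulrA s1 mul1r.
rewrite -(prednK (order_gt0 sigma)) addSn iterS => zE.
by exists (iter (#[sigma]%g.-1 + #[sigma]%g.-1.+1) Phi z).
Qed.

End PlueckerCone.

(** * Weight vectors as exchange relations and as scalings of the cone *)

(** Take [I] to list [K] and [L] to list [K'] together with [x] and [y]. *)
Lemma plucker_weight_exchange k n m (lam : 'I_m.+1 -> schubert k.+1 n) b :
  plucker_weight lam b ->
  forall (K K' : {set 'I_n}) (x y : 'I_n) r s r' s', #|K| = k -> #|K'| = k ->
    x != y -> x \notin K -> y \notin K -> x \notin K' -> y \notin K' ->
    setof (lam r) = x |: K -> setof (lam s) = y |: K' ->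
    setof (lam r') = y |: K -> setof (lam s') = x |: K' ->
    (b r + b s = b r' + b s')%N.
Proof.
move=> [_ bE] K K' x y r s r' s' cK cK' xy xK yK xK' yK' rE sE r'E s'E.
have [I IE] := setof_surj cK.
have [|L LE] := @setof_surj k.+2 n (x |: (y |: K')).
  by rewrite !cardsU1 !inE negb_or xy xK' yK' cK'.
have [|j jE] := @setof_seqat _ _ L x; first by rewrite LE setU11.
have [|j' j'E] := @setof_seqat _ _ L y; first by rewrite LE setUCA setU11.
apply: (bE I L j j'); rewrite ?jE ?j'E ?IE ?LE //.
  by rewrite setU1K ?inE ?negb_or ?xy.
by rewrite setUCA setU1K ?inE ?negb_or 1?eq_sym ?xy.
Qed.

(** Converse of [plucker_weight_exchange]: [K'] is [L] without its entries at [j] and [j']. Equal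
    entries give equal indices by injectivity. *)
Lemma plucker_weight_sets k n m (lam : 'I_m.+1 -> schubert k.+1 n) b :
  injective (fun i => setof (lam i)) -> (forall i, 0 < b i)%N ->
  (forall (K K' : {set 'I_n}) (x y : 'I_n) r s r' s', #|K| = k -> #|K'| = k ->
    x != y -> x \notin K -> y \notin K -> x \notin K' -> y \notin K' ->
    setof (lam r) = x |: K -> setof (lam s) = y |: K' ->
    setof (lam r') = y |: K -> setof (lam s') = x |: K' ->
    (b r + b s = b r' + b s')%N) ->
  plucker_weight lam b.
Proof.
move=> lam_inj b_gt0 bE; split=> // I L j j' r s r' s' jI j'I rE sE r'E s'E.
have [jj'|jj'] := eqVneq (seqat L j) (seqat L j').
  have -> : r = r' by apply: lam_inj; rewrite /= rE r'E jj'.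
  by have -> : s = s' by apply: lam_inj; rewrite /= sE s'E jj'.
pose K' := setof L :\ seqat L j :\ seqat L j'.
have j'L : seqat L j' \in setof L :\ seqat L j.
  by rewrite !inE eq_sym jj' mem_tnth.
have jL : seqat L j \in setof L :\ seqat L j' by rewrite !inE jj' mem_tnth.
apply: (bE (setof I) K' (seqat L j) (seqat L j')) => //.
- exact: card_setof.
- apply/eqP; have := cardsD1 (seqat L j) (setof L).
  by rewrite card_setof mem_seqat (cardsD1 (seqat L j')) j'L !add1n => /eqP; rewrite !eqSS eq_sym.
- by rewrite !inE eqxx andbF.
- by rewrite setD11.
- by rewrite sE setD1K.
- by rewrite s'E /K' setDDl [[set _] :|: [set _]]setUC -setDDl setD1K.
Qed.

Lemma plucker_weight_linear k n m (lam : 'I_m.+1 -> schubert k.+1 n) b :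
  bijective lam -> (k.+1 < n)%N -> plucker_weight lam b ->
  exists N, (0 < N)%N /\ exists c : 'I_n -> nat, forall i j,
    (N * b i + \sum_(x in setof (lam j)) c x =
     N * b j + \sum_(x in setof (lam i)) c x)%N.
Proof.
(* The sum has one term on sets of size [k.+1] and is empty otherwise, so [B] extends [b] by 0. *)
move=> lam_bij ltkn hb; pose B S := (\sum_(i | setof (lam i) == S) b i)%N.
have BE i : B (setof (lam i)) = b i.
  by apply: big_pred1 => j; rewrite (inj_eq (setof_lam_inj lam_bij)).
have [|N [N_gt0 [c cE]]] := @exchange_weight_linear n k B ltkn.
  move=> K K' x y cK cK' xy xK yK xK' yK'.
  have sz z (J : {set 'I_n}) : #|J| = k -> z \notin J -> #|z |: J| = k.+1.
    by rewrite cardsU1 => -> ->.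
  have [r rE] := setof_lam_surj lam_bij (sz _ _ cK xK).
  have [s sE] := setof_lam_surj lam_bij (sz _ _ cK' yK').
  have [r' r'E] := setof_lam_surj lam_bij (sz _ _ cK yK).
  have [s' s'E] := setof_lam_surj lam_bij (sz _ _ cK' xK').
  rewrite -rE -sE -r'E -s'E !BE.
  exact: (plucker_weight_exchange hb cK cK' xy).
exists N; split=> //; exists c => i j; rewrite -!BE.
by apply: cE; apply: card_setof.
Qed.

(* The diagonal matrix with entries [(2 ^+ N) ^+ b i] is, up to a scalar, the
   [k]-th exterior power of the one with entries [2 ^+ c x]. *)
Lemma in_Pl_weight (F : numFieldType) k n m (lam : 'I_m.+1 -> schubert k.+1 n) b :
  bijective lam -> (k.+1 < n)%N -> plucker_weight lam b ->
  exists2 N, (0 < N)%N & forall z : 'rV[F]_m.+1, in_Pl lam z ->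
    in_Pl lam (\row_i (2 ^+ (N * b i) * z 0 i)).
Proof.
move=> lam_bij ltkn hb.
have [N [N_gt0 [c cE]]] := plucker_weight_linear lam_bij ltkn hb.
exists N => // z zPl; pose g x : F := 2 ^+ c x.
have two0 : (2 : F) != 0 by rewrite pnatr_eq0.
have gE i : \prod_(j in setof (lam i)) g j = 2 ^+ (\sum_(x in setof (lam i)) c x)%N.
  by rewrite -expr_sum.
(* Normalised at the index [ord0]; [cE] makes the same ratio correct at every index. *)
pose C : F := 2 ^+ (N * b ord0) / \prod_(j in setof (lam ord0)) g j.
have g0 x : g x != 0 by rewrite expf_neq0.
have C0 : C != 0 by rewrite mulf_neq0 ?invr_neq0 ?gE ?expf_neq0.
have := in_Pl_diag lam_bij (ltn0Sn k) C0 g0 zPl.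
congr in_Pl; apply/rowP => i; rewrite !mxE; congr (_ * _).
rewrite /C mulrAC; apply: (canLR (mulfK _)); first by rewrite gE expf_neq0.
by rewrite !gE -!exprD -cE.
Qed.

(** * Transport of weight vectors along Plücker permutations *)

Lemma plucker_perm_weight (F : numFieldType) k n m
    (lam : 'I_m.+1 -> schubert k n) (sigma : {perm 'I_m.+1}) b :
  (0 < k < n)%N -> bijective lam -> plucker_perm F lam sigma ->
  plucker_weight lam b -> plucker_weight lam (fun i => b (sigma i)).
Proof.
case: k lam => // k lam ltkn lam_bij [t [t1 tPl]] hb.
have [N N_gt0 bPl] := in_Pl_weight F lam_bij ltkn hb.
(* Write [z] as the image of some [y] under the signed permutation, scale [y], and map back; the
   signs commute with the scaling. *)
have scaledPl z : in_Pl lam z -> in_Pl lam (\row_i (2 ^+ (N * b (sigma i)) * z 0 i) : 'rV[F]_m.+1).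
  case/(plucker_perm_surj t1 tPl) => y /bPl/tPl + <-.
  by congr in_Pl; apply/rowP => i; rewrite !mxE mulrCA.
apply: plucker_weight_sets => [|i|]; [exact: setof_lam_inj | by case: hb |].
move=> K K' x y r s r' s' cK cK' xy xK yK xK' yK' rE sE r'E s'E.
have [u [uX uK uK']] := wedges_two_sets F cK cK'.
have xX : x \notin K :|: K' by rewrite inE negb_or xK.
have yX : y \notin K :|: K' by rewrite inE negb_or yK.
pose v : 'rV[F]_n := \row_j ((j == x) || (j == y))%:R.
pose w i := if unlift ord0 i is Some j then u j else v.
have wxy (T : {set 'I_n}) : x \in T -> y \in T -> wedges w T = 0.
  move=> xT yT; rewrite wedges_cons wedge_vecE big1 // => j jT; rewrite mxE.
  suff -> : wedges u (T :\ j) = 0 by rewrite !mulr0.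
  apply/eqP; apply/negPn/negP => /(wedges_support uX)/subsetP sX.
  have [jx|jx] := eqVneq j x.
    by have := sX y; rewrite in_setD1 yT jx eq_sym xy (negPf yX) => /(_ isT).
  by have := sX x; rewrite in_setD1 xT eq_sym jx (negPf xX) => /(_ isT).
(* Since [u] lives off [x] and [y], the coordinate of [w] at [z |: J] is that of [u] at [J] up to
   sign. *)
have wJ z (J : {set 'I_n}) : z \in [set x; y] -> J \subset K :|: K' ->
    wedges u J != 0 -> wedges w (z |: J) != 0.
  move=> zxy /subsetP JX uJ.
  have zJ : z \notin J.
    by apply: contraL zxy => /JX zX; rewrite !inE negb_or; apply/andP; split;
       [apply: contraNneq xX | apply: contraNneq yX] => <-.
  rewrite wedges_cons wedge_vecE big_setU1 //= big1 => [|j jJ].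
    rewrite addr0 setU1K // mxE; move: zxy; rewrite !inE => ->.
    by rewrite mul1r mulf_neq0 // signr_eq0.
  have jX := JX _ jJ; rewrite mxE.
  have -> : (j == x) = false by apply: contraNF xX => /eqP <-.
  have -> : (j == y) = false by apply: contraNF yX => /eqP <-.
  by rewrite mul0r mulr0.
have wr : wedges w (setof (lam r)) != 0.
  by rewrite rE wJ ?subsetUl // !inE eqxx.
have ws : wedges w (setof (lam s)) != 0.
  by rewrite sE wJ ?subsetUr // !inE eqxx orbT.
have /scaledPl/(in_PlP lam_bij)[a [aE _]] :
    in_Pl lam (\row_i wedges w (setof (lam i)) : 'rV[F]_m.+1).
  apply/(in_PlP lam_bij); exists w; split=> [i|w0]; first by rewrite mxE.
  by move: wr; rewrite w0 ffunE eqxx.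
have axy (T : {set 'I_n}) : x \in T -> y \in T -> wedges a T = 0.
  move=> xT yT; have [/eqP/(setof_lam_surj lam_bij)[i iE]|cT] := boolP (#|T| == k.+1).
    by rewrite -iE aE !mxE iE wxy // mulr0.
  by apply/eqP; apply: contraNT cT => /wedges_card ->.
have := wedges_two_term xy xK yK xK' yK' axy.
have := wedges_two_term xy xK yK xK' yK' wxy.
rewrite -rE -sE -r'E -s'E !aE !mxE => w2.
have sq (c d p q : F) : (c * p * (d * q)) ^+ 2 = (c * d) ^+ 2 * (p * q) ^+ 2.
  by rewrite mulrACA exprMn.
rewrite [LHS]sq [RHS]sq -w2.
(* Cancelling the common non-zero product leaves an equality of powers of 2 with exponents
   [N * (_ + _) * 2]; in characteristic 0 the exponents agree. *)
move/(mulIf (expf_neq0 2 (mulf_neq0 wr ws))).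
rewrite -!exprD -!mulnDr -!exprM -!natrX => /eqP.
rewrite eqr_nat eqn_exp2l // eqn_pmul2r // eqn_pmul2l // => /eqP; exact.
Qed.

Theorem lemma3p3 (R : realType) (k n m : nat) (hk : (1 <= k)%N) (hkn : (k < n)%N)
    (hm : m.+1 = 'C(n, k)) (lam : 'I_m.+1 -> schubert k n)
    (hlam : schubert_enum lam) (sigma : {perm 'I_m.+1})
    (hsigma : plucker_perm R[i] lam sigma) (b : 'I_m.+1 -> nat)
    (hb : plucker_weight lam b) :
  plucker_weight lam (fun i => b (sigma i)).
Proof.
case: hlam => lam_bij _; apply: plucker_perm_weight hsigma hb => //.
exact/andP.
Qed.
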